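(* Let $k\ge 7$ be an integer and let $a$ be a real number with $0<a<1$. If $Q\in\mathbb{R}[x]$ has nonnegative coefficients and the polynomial $$(1+a x^2+x^k)\,Q(x)$$ has all coefficients in $\{0,1\}$, then $Q=0$. *)

(* Defs.v *)
From mathcomp Require Import all_boot all_order all_algebra.
From mathcomp Require Import reals.

(* Main.v *)
Require Import Defs.
From mathcomp Require Import all_boot all_order all_algebra all_field.
From mathcomp Require Import reals boolp.
From mathcomp Require Import zify lra ring.
Import Order.TTheory GRing.Theory Num.Theory.
Local Open Scope ring_scope.

(** Write [C] for the product and [q n], [c n] for the coefficients of [Q] and
    [C], shifted so that [q 0 <> 0]. Since every term of
    [c n = q n + a q (n - 2) + q (n - k)] is nonnegative, a positive [q m]
    makes [c] equal to 1 at [m], [m + 2] and [m + k]. For even [k] this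
    already forces [c k] above 1 ([even_exponent]).

    For odd [k] the argument compares two facts about [C].

    The first is that the bottom of [C] is rigid ([product_prefix]): below
    [4 k + 4], [c n] is 1 for even [n] and for odd [n >= k], and 0 otherwise.
    Hence [(1 - x ^ 2) C] agrees with [1 + x ^ k] below [4 k + 4], and a root
    [z] of [C] in the unit disc satisfies
    [|1 + z ^ k| (1 - |z|) <= |z| ^ (4 k + 4)] ([prefix_root_bound]).

    The second is arithmetic. Dividing the fixed integer polynomial [C] by
    [1 + y x ^ 2 + x ^ k] as power series in [x] gives coefficients in [Z[y]],
    and those of even index [2 s] are, up to sign, monic of degree [s]. They
    vanish at [y = a] once the index exceeds the degree of [Q]. So [a] is a
    nonzero algebraic integer, and one of its conjugates [al] has modulus at
    least 1 ([conjugate_norm_ge1]); conjugation carries the divisibility over,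
    so [1 + al x ^ 2 + x ^ k] divides [C] as well ([conjugate_divisor]).

    It remains to find a root [z] of [1 + al x ^ 2 + x ^ k] violating the
    bound. If [v] runs over the [k]-th powers of the roots, then [v] runs over
    the roots of [(1 + v) ^ k + al ^ k v ^ 2], so the mean of [1 / v] is
    [-1]. Some [v] therefore has [Re (1 / v) <= -1], that is,
    [|v| ^ 2 + |1 + v| ^ 2 <= 1] ([trinomial_root_disc]). Because [|al| >= 1],
    [|1 + z ^ k| = |al| |z| ^ 2 >= |z| ^ 2], and an inequality in the single
    real number [|z|] gives the contradiction ([small_modulus_absurd]). *)

(** * The coefficients forced at the bottom of the product *)

Lemma coef_prod (R : comNzRingType) (k : nat) (a : R) (Q : {poly R}) (n : nat) :
  ((1 + a *: 'X^2 + 'X^k) * Q)`_n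
  = Q`_n + a * (if (n < 2)%N then 0 else Q`_(n - 2))
    + (if (n < k)%N then 0 else Q`_(n - k)).
Proof.
by rewrite !mulrDl mul1r !coefD -scalerAl coefZ !coefXnM.
Qed.

(** The quotient and the product enter as coefficient sequences, because the
    arguments below follow the convolution identity index by index. *)
Definition zero_one_product (R : realFieldType) (k : nat) (a : R)
    (q c : nat -> R) :=
  [/\ forall n, 0 <= q n, forall n, c n = 0 \/ c n = 1 &
      forall n, c n = q n + a * (if (n < 2)%N then 0 else q (n - 2)%N)
                      + (if (n < k)%N then 0 else q (n - k)%N)].

(** The engine of the whole section: nothing can cancel a positive
    contribution, and the only positive value allowed is 1. *)
Lemma product_eq1 (R : realFieldType) (k : nat) (a : R) (q c : nat -> R) (m : nat) :
  0 < a -> zero_one_product R k a q c -> 0 < q m ->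
  [/\ c m = 1, c m.+2 = 1 & c (m + k)%N = 1].
Proof.
move=> a0 [q0 c01 cE] qm.
have aq n : 0 <= a * q n by apply: mulr_ge0; [exact: ltW|exact: q0].
have aqm : 0 < a * q m by exact: mulr_gt0.
have pos (b : bool) (x : R) : 0 <= x -> 0 <= (if b then 0 else x) by case: b.
have apos (b : bool) n : 0 <= a * (if b then 0 else q n).
  by case: b; rewrite ?mulr0.
have one n : 0 < c n -> c n = 1 by case: (c01 n) => ->; rewrite ?ltxx.
split; apply: one; rewrite cE.
- by have := apos (m < 2)%N (m - 2)%N; have := pos (m < k)%N _ (q0 (m - k)%N); lra.
- rewrite !ltnS ltn0 subSS subSS subn0.
  by have := pos (m.+2 < k)%N _ (q0 (m.+2 - k)%N); have := q0 m.+2; lra.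
- rewrite (leq_gtF (leq_addl m k)) addnK.
  by have := apos (m + k < 2)%N (m + k - 2)%N; have := q0 (m + k)%N; lra.
Qed.

Lemma product_le1 (R : realFieldType) (k : nat) (a : R) (q c : nat -> R) (n : nat) :
  0 < a -> zero_one_product R k a q c -> q n <= 1.
Proof.
move=> a0 [q0 c01 cE]; have : c n <= 1 by case: (c01 n) => ->; rewrite ?ler01.
have : 0 <= a * (if (n < 2)%N then 0 else q (n - 2)%N).
  by case: ifP; rewrite ?mulr0 // mulr_ge0 // ltW.
have : 0 <= (if (n < k)%N then 0 else q (n - k)%N) by case: ifP.
by rewrite (cE n); lra.
Qed.

Lemma product_low (R : realFieldType) (k : nat) (a : R) (q c : nat -> R) (n : nat) :
  zero_one_product R k a q c -> (n.+2 < k)%N -> c n.+2 = q n.+2 + a * q n.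
Proof. by move=> [_ _ ->] nk; rewrite nk /= subSS subSS subn0 addr0. Qed.

Lemma product_high (R : realFieldType) (k : nat) (a : R) (q c : nat -> R) (n : nat) :
  zero_one_product R k a q c -> (k <= n.+2)%N ->
  c n.+2 = q n.+2 + a * q n + q (n.+2 - k)%N.
Proof. by move=> [_ _ ->] nk; rewrite (leq_gtF nk) /= !subSS subn0. Qed.

(** Along the even indices below [k] only the terms [q n] and [a q (n - 2)] are
    present, so positivity propagates: [q n = 1 - a q (n - 2) >= 1 - a]. *)
Lemma product_low_even (R : realFieldType) (k : nat) (a : R) (q c : nat -> R) :
  0 < a -> a < 1 -> (0 < k)%N -> zero_one_product R k a q c -> q 0%N != 0 ->
  q 0%N = 1 /\ forall i, (i.*2 < k)%N -> 0 < q i.*2.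
Proof.
move=> a0 a1 k0 H q0; have [qge c01 cE] := H.
have q01 : q 0%N = 1.
  have := cE 0%N; rewrite k0 /= mulr0 !addr0 => c0.
  by case: (c01 0%N) q0; rewrite c0 => ->; rewrite ?eqxx.
split=> //; elim=> [|i IH] ik; first by rewrite q01 ltr01.
have qi : 0 < q i.*2 by apply: IH; lia.
have [_ ci _] := product_eq1 R k a q c i.*2 a0 H qi.
move: ci; rewrite doubleS (product_low R k a q c) //.
by have := product_le1 R k a q c i.*2 a0 H => ?; nra.
Qed.

(** For even [k] the chain of positive even coefficients reaches [k - 2], and
    then [c k >= q 0 + a q (k - 2) > 1]. *)
Lemma even_exponent (R : realFieldType) (k : nat) (a : R) (q c : nat -> R) :
  0 < a -> a < 1 -> (2 < k)%N -> ~~ odd k -> zero_one_product R k a q c ->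
  q 0%N = 0.
Proof.
move=> a0 a1 k2 kev H; apply/eqP; apply: contraT => q0.
have [q01 low] := product_low_even R k a q c a0 a1 (ltnW (ltnW k2)) H q0.
have [j kE] : exists j, k = j.+1.*2 by exists k./2.-1; lia.
have qj : 0 < q j.*2 by apply: low; rewrite kE doubleS.
have q0pos : 0 < q 0%N by rewrite q01 ltr01.
have [_ _ ck] := product_eq1 R k a q c 0%N a0 H q0pos.
have := product_high R k a q c j.*2 H; rewrite -doubleS -kE subnn -[k in c k]add0n ck q01.
move=> /(_ (leqnn _)); have [qge _ _] := H; have := qge k.
by have : 0 < a * q j.*2 by [exact: mulr_gt0]; lra.
Qed.

(** As [q 0 = 1] uses up all of [c k], both [q k] and [q (k - 2)] vanish. From
    there one descends: if [q n = 0] then [c n = a q (n - 2) < 1], hence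
    [c n = 0] and [q (n - 2) = 0]. *)
Lemma product_low_odd (R : realFieldType) (k : nat) (a : R) (q c : nat -> R) :
  0 < a -> a < 1 -> (2 < k)%N -> odd k -> zero_one_product R k a q c ->
  q 0%N != 0 -> forall n, odd n -> (n <= k)%N -> q n = 0.
Proof.
move=> a0 a1 k2 kodd H q0.
have [q01 _] := product_low_even R k a q c a0 a1 (ltnW (ltnW k2)) H q0.
have [qge c01 _] := H.
have le1 n := product_le1 R k a q c n a0 H.
have q0pos : 0 < q 0%N by rewrite q01 ltr01.
have [_ _ ck] := product_eq1 R k a q c 0%N a0 H q0pos.
have [l kE] : exists l, k = l.*2.+3 by exists (k./2.-1); lia.
have := product_high R k a q c l.*2.+1 H; rewrite -kE subnn -[k in c k]add0n ck q01.
move=> /(_ (leqnn _)) {}ck.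
have aq n : 0 <= a * q n by apply: mulr_ge0; [exact: ltW|exact: qge].
have aq0 n : a * q n = 0 -> q n = 0.
  by move/eqP; rewrite mulf_eq0 (gt_eqF a0) => /eqP.
have qk : q k = 0 by have := qge k; have := aq l.*2.+1; lra.
have zodd i : (i <= l)%N -> q (l - i).*2.+1 = 0.
  elim: i => [|i IH] il; first by rewrite subn0; apply: aq0; lra.
  have {}IH := IH (ltnW il).
  have liE : (l - i = (l - i.+1).+1)%N by lia.
  have : c (l - i).*2.+1 = a * q (l - i.+1).*2.+1.
    rewrite {1}liE doubleS (product_low R k a q c) //; last by lia.
    by rewrite -doubleS -liE IH add0r.
  have := le1 (l - i.+1).*2.+1; have := qge (l - i.+1).*2.+1.
  by case: (c01 (l - i).*2.+1) => -> h0 h1 E; [apply: aq0|nra].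
move=> n nodd nk; have [-> //|nk'] := eqVneq n k.
have -> : n = (l - (l - n./2)).*2.+1 by lia.
by apply: zodd; lia.
Qed.

(** A first exception [N >= k] has [c N = 0], hence
    [q (N - 2) = q (N - k) = 0]. As [k] is odd, one of these two indices is
    even, so it is enough that [q] is positive at the even indices up to
    [4 k]. This follows from [a <= 1 / 2], itself a consequence of
    [q (k + 4) = a - 2 a ^ 2 >= 0]. *)
Lemma product_prefix (R : realFieldType) (k : nat) (a : R) (q c : nat -> R) :
  0 < a -> a < 1 -> (4 < k)%N -> odd k -> zero_one_product R k a q c ->
  q 0%N != 0 ->
  forall n, (n < 4 * k + 4)%N -> c n = (~~ odd n || (k <= n)%N)%:R.
Proof.
move=> a0 a1 k4 kodd H q0.
have k2 : (2 < k)%N by lia.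
have k0 : (0 < k)%N by lia.
have [q01 low] := product_low_even R k a q c a0 a1 k0 H q0.
have zodd := product_low_odd R k a q c a0 a1 k2 kodd H q0.
have [qge c01 cE] := H.
have le1 n := product_le1 R k a q c n a0 H.
have aq n : 0 <= a * q n by apply: mulr_ge0; [exact: ltW|exact: qge].
have eq1 m := product_eq1 R k a q c m a0 H.
have qk : q k = 0 by apply: zodd.
have a2 : 2%:R * a <= 1.
  have p2 : 0 < q 2%N by apply: (low 1%N).
  have p4 : 0 < q 4%N by apply: (low 2%N).
  have [e2 _ o2] := eq1 _ p2; have [e4 _ o4] := eq1 _ p4.
  have := product_low R k a q c 0%N H k2; have := product_low R k a q c 2%N H k4.
  have := product_high R k a q c k H (leqW (leqnSn k)).
  have := product_high R k a q c k.+2 H (leqW (leqW (leqW (leqnSn k)))).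
  rewrite e2 e4 (_ : c k.+2 = 1) // (_ : c k.+4 = 1) //.
  have -> : (k.+2 - k = 2)%N by rewrite -addn2 addKn.
  have -> : (k.+4 - k = 4)%N by rewrite -addn4 addKn.
  rewrite q01 qk.
  have : 0 <= q k.+4 by [].
  move: (q 2%N) (q 4%N) (q k.+2) (q k.+4) => x2 x4 y2 y4 h {}o4 {}o2 {}e4 {}e2.
  have : 0 <= a * (1 - 2%:R * a).
    have x2E : x2 = 1 - a by lra.
    have y2E : y2 = a by lra.
    by move: e4 o4; rewrite x2E y2E => e4 o4; lra.
  by rewrite pmulr_rge0 // subr_ge0.
have recL n := product_low R k a q c n H.
have recH n := product_high R k a q c n H.
elim/ltn_ind => N IH NM.
have cge n : (n < N)%N -> (k <= n)%N -> c n = 1.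
  by move=> nN kn; rewrite IH ?kn ?orbT //; exact: ltn_trans NM.
have ceven i : (i.*2 < N)%N -> c i.*2 = 1.
  by move=> iN; rewrite IH ?odd_double //; exact: ltn_trans NM.
have evenS i : (i < k)%N -> (i.+1.*2 < N)%N -> q i.+1.*2 = 1 - a * q i.*2.
  move=> ik /ceven; rewrite doubleS; have [ik2|ki2] := ltnP i.*2.+2 k.
    by rewrite recL //; lra.
  by rewrite recH // (zodd (i.*2.+2 - k)%N); [lra|lia|lia].
(* From [k] to [3 k] the coefficients of odd index are at most [a], since
   [q (k + 2 j + 2) = a (q (2 j) - q (k + 2 j))]. *)
have high_le j : (j <= k)%N -> (k + j.*2 < N)%N -> q (k + j.*2)%N <= a.
  case: j => [|j] jk jN; first by rewrite addn0 qk ltW.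
  have := cge _ jN (leq_addr _ _); rewrite doubleS !addnS.
  rewrite recH; last by lia.
  rewrite (_ : ((k + j.*2).+2 - k = j.+1.*2)%N); last by lia.
  rewrite evenS; [|by lia|by lia].
  by have := aq (k + j.*2)%N; have := le1 j.*2; nra.
(* Past [2 k] the recursion reads [q (2 i) = 1 - a q (2 i - 2) - q (2 i - k)].
   Here [q (2 i - 2) < 1] strictly, because [q (2 i - 4) > 0], and the last
   term is at most [a], so [q (2 i) > 1 - 2 a >= 0]. *)
have pos i : (i.*2 < N)%N -> (i <= k.*2)%N -> 0 < q i.*2.
  elim/ltn_ind: i => -[|i] IHi iN ik; first by rewrite q01 ltr01.
  have [ik'|ki] := ltnP i k.
    by rewrite evenS //; have := le1 i.*2; nra.
  case: i ki IHi iN ik => [|i] ki IHi iN ik; first by lia.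
  have qi : 0 < q i.*2 by apply: IHi; lia.
  have ci : c i.+1.*2 = 1 by apply: ceven; lia.
  have := ceven _ iN; rewrite doubleS recH; last by lia.
  rewrite (_ : (i.+1.*2.+2 - k = k + (i.+2 - k).*2)%N); last by lia.
  have oi : q (k + (i.+2 - k).*2)%N <= a.
    have h1 : (i.+2 - k <= k)%N by lia.
    have h2 : (k + (i.+2 - k).*2 < N)%N by lia.
    exact: (high_le _ h1 h2).
  move: ci; rewrite doubleS recH; last by lia.
  have := qge (i.*2.+2 - k)%N; have aqi : 0 < a * q i.*2 by exact: mulr_gt0.
  move: oi; move: (q _) (q i.*2) aqi (q (i.*2.+2 - k)%N) => o x ax z; nra.
have [nk|kn] := ltnP N k.
  rewrite orbF; have [oN|eN] := boolP (odd N); last first.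
    have NE : N = N./2.*2 by lia.
    by have [] := eq1 N; rewrite // NE low // -NE.
  case: N oN nk {IH NM cge ceven evenS high_le pos} => [|[|n]] //= oN nk.
    by have := cE 1%N; rewrite (ltn_trans _ k2) //= mulr0 !addr0 => ->; apply: zodd; lia.
  by rewrite recL // !zodd ?mulr0 ?addr0 //; lia.
rewrite orbT; case: (c01 N) => // cN; exfalso.
have N2 : (2 <= N)%N by lia.
have cN2 : c (N - 2).+2 = 0 by rewrite -cN; congr c; lia.
move: (cN2); rewrite recH; last by lia.
rewrite (_ : ((N - 2).+2 - k = N - k)%N); last by lia.
have h1 := qge (N - 2).+2; have h2 := aq (N - 2)%N; have h3 := qge (N - k)%N.
have [oN|eN] := boolP (odd N) => E.
  have evk : ~~ odd (N - k) by rewrite oddB // oN kodd.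
  have : 0 < q (N - k)./2.*2.
    by apply: pos; rewrite ?even_halfK ?leq_double //; clear -NM N2 kn k4; lia.
  by rewrite even_halfK //; lra.
have ev2 : ~~ odd (N - 2) by rewrite oddB // addbF.
have : 0 < q (N - 2)./2.*2.
  by apply: pos; rewrite ?even_halfK //; clear -NM N2 kn k4; lia.
by rewrite even_halfK // => /(mulr_gt0 a0); lra.
Qed.

(** * A conjugate of large modulus *)

Lemma ratr_intr_poly (K : numFieldType) (g : {poly int}) :
  map_poly (ratr : rat -> K) (map_poly intr g) = map_poly intr g.
Proof. by rewrite -map_poly_comp; apply: eq_map_poly => x /=; rewrite ratr_int. Qed.

(** The minimal polynomial, as a rational polynomial of least size vanishing at
    [a]: the remainder of any other one modulo it vanishes at [a] too. *)
Lemma min_rat_poly (K : numFieldType) (a : K) (p : {poly rat}) :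
  p != 0 -> root (map_poly ratr p) a ->
  exists f : {poly rat}, [/\ f != 0, root (map_poly ratr f) a &
    forall g : {poly rat}, root (map_poly ratr g) a -> f %| g].
Proof.
move=> p0 pa.
pose P n := `[< exists f : {poly rat}, [/\ f != 0, root (map_poly (ratr : rat -> K) f) a & size f = n] >].
have exP : exists n, P n by exists (size p); apply/asboolP; exists p.
case: (ex_minnP exP) => n /asboolP[f [f0 fa szf]] nmin.
exists f; split=> // g ga; rewrite /dvdp; apply: contraT => r0.
suff : (n <= size (g %% f)%R)%N by rewrite -szf leqNgt ltn_modpN0.
apply: nmin; apply/asboolP; exists (g %% f); split=> //.
have := ga; rewrite {1}(divp_eq g f) rmorphD rmorphM !rootE !hornerE.
by rewrite (rootP fa) mulr0 add0r.
Qed.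

(** By Gauss's lemma the primitive minimal polynomial [h] of [a] divides [p] over
    the integers, so its leading coefficient is a unit. Its constant term is a
    nonzero integer, hence the product of its roots has modulus at least 1. *)
Lemma conjugate_norm_ge1 (K : numFieldType) (F : numClosedFieldType) (a : K)
    (p : {poly int}) :
  a != 0 -> root (map_poly intr p) a -> `|lead_coef p| = 1 ->
  exists al : F, 1 <= `|al| /\
    forall g : {poly int}, root (map_poly intr g) a -> root (map_poly intr g) al.
Proof.
move=> a0 pa p1.
have p0 : p != 0 by rewrite -lead_coef_eq0 -normr_eq0 p1 oner_neq0.
have inj : injective (intr : int -> rat) by exact: intr_inj.
have [||f [f0 fa fmin]] := @min_rat_poly K a (map_poly intr p).
- by rewrite -(rmorph0 (map_poly intr)) (inj_eq (map_inj_poly inj _)).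
- by rewrite ratr_intr_poly.
have fp : f %| map_poly intr p by apply: fmin; rewrite ratr_intr_poly.
have [h [c c0 fE] [r pE]] := dvdpP_rat_int fp.
have ha : root (map_poly intr h) a.
  have := fa; rewrite fE map_polyZ /= rootZ ?fmorph_eq0 //.
  by rewrite ratr_intr_poly.
have h1 : `|lead_coef h| = 1.
  have := congr1 absz p1; rewrite pE lead_coefM absz_id abszM => /eqP.
  by rewrite muln_eq1 => /andP[/eqP h1 _]; rewrite -abszE h1.
(* Otherwise [h / 'X] would be a smaller polynomial vanishing at [a]. *)
have h0 : h`_0 != 0.
  apply/eqP => h0.
  have [q hq] : exists q, h = q * 'X.
    have /factor_theorem[q ->] : root h 0 by rewrite rootE horner_coef0 h0.
    by exists q; rewrite subr0.
  have qa : root (map_poly intr q) a.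
    have := ha; rewrite hq rmorphM /= map_polyX rootM rootX (negPf a0) orbF.
    by [].
  have : f %| map_poly intr q by apply: fmin; rewrite ratr_intr_poly.
  have q0 : map_poly intr q != 0 :> {poly rat}.
    by apply: contra_neq f0 => q0; rewrite fE hq rmorphM /= q0 mul0r scaler0.
  move=> /(dvdp_leq q0); rewrite fE hq rmorphM /= map_polyX.
  by rewrite size_scale // size_mulX // ltnn.
have rootal (al : F) : root (map_poly intr h) al ->
    forall g : {poly int}, root (map_poly intr g) a -> root (map_poly intr g) al.
  move=> hal g ga.
  have : f %| map_poly intr g by apply: fmin; rewrite ratr_intr_poly.
  rewrite fE dvdpZl // -(dvdp_map (ratr : {rmorphism rat -> F})) !ratr_intr_poly.
  by move=> /dvdpP[q ->]; rewrite rootM hal orbT.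
have [s hs] := closed_field_poly_normal (map_poly intr h : {poly F}).
have lh : lead_coef (map_poly intr h : {poly F}) = (lead_coef h)%:~R.
  by apply: lead_coef_map_inj => //; exact: intr_inj.
have prods : 1 <= \prod_(z <- s) `|z|.
  have : (map_poly intr h : {poly F})`_0 = (h`_0)%:~R by rewrite coef_map.
  rewrite hs coefZ coef0_prod_XsubC lh => /(congr1 Num.norm).
  rewrite !normrM normrX normrN1 expr1n mul1r -!intr_norm h1 mul1r normr_prod => ->.
  by rewrite -[1]/(1%:~R) ler_int -gtz0_ge1 normr_gt0.
have hn0 : h != 0 by apply: contra_neq h0 => ->; rewrite coef0.
have s0 : s != [::].
  have := root_size_gt1 _ ha; rewrite size_map_inj_poly //; last exact: intr_inj.
  rewrite -(@size_map_inj_poly _ F intr) //; last exact: intr_inj.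
  rewrite -size_poly_eq0 size_map_inj_poly ?size_poly_eq0 //; last exact: intr_inj.
  move=> /(_ hn0); apply: contraL => /eqP s0; rewrite hs s0 big_nil alg_polyC.
  by rewrite size_polyC; case: (_ == 0).
have [al als al1] : exists2 al, al \in s & 1 <= `|al|.
  apply/hasP; apply: contraLR prods => /hasPn small.
  rewrite real_leNgt ?rpred1 // ?negbK; last by apply: rpred_prod => z _; exact: normr_real.
  have {}small z : z \in s -> `|z| < 1.
    by move=> zs; rewrite real_ltNge ?small // normr_real.
  case: s s0 small {hs} => // z s _ small; rewrite big_cons.
  apply: (le_lt_trans _ (small z _)); last exact: mem_head.
  rewrite ler_piMr // big_seq.
  apply: prodr_ile1 => y ys.
  by rewrite normr_ge0 ltW // small // inE ys orbT.
exists al; split=> //; apply: rootal.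
rewrite hs rootZ ?lh ?root_prod_XsubC // intr_eq0 -normr_eq0 h1 oner_neq0 //.
Qed.

(** Division of [C] by [1 + y x ^ 2 + x ^ k] as power series in [x], with [y] the
    indeterminate of [{poly int}]. The argument [d] is fuel for the course of
    values recursion; any [d > n] gives the same value. *)
Fixpoint quot_rec (k : nat) (C : {poly int}) (d n : nat) : {poly int} :=
  if d is d'.+1 then
    (C`_n)%:P - 'X * (if (n < 2)%N then 0 else quot_rec k C d' (n - 2))
    - (if (n < k)%N then 0 else quot_rec k C d' (n - k))
  else 0.

Definition quot k C n := quot_rec k C n.+1 n.

Lemma quot_rec_fuel k C d n : (0 < k)%N -> (n < d)%N ->
  quot_rec k C d n = quot k C n.
Proof.
move=> k0; rewrite /quot; move: {2}n (leqnn n) => N.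
elim: N d n => [|N IH] [|d] n //= nN nd.
  have -> : n = 0%N by lia.
  by rewrite /= k0.
by congr (_ - _ * _ - _); case: ltnP => // h; rewrite [LHS]IH ?[RHS]IH //; lia.
Qed.

Lemma quotE k C n : (0 < k)%N ->
  quot k C n = (C`_n)%:P - 'X * (if (n < 2)%N then 0 else quot k C (n - 2))
    - (if (n < k)%N then 0 else quot k C (n - k)).
Proof.
move=> k0; rewrite {1}/quot /=.
by congr (_ - _ * _ - _); case: ltnP => // h; rewrite quot_rec_fuel //; lia.
Qed.

Lemma quot_evalE (L : fieldType) (k : nat) (C : {poly int}) (b : L) (n : nat)
    (q := fun m => (map_poly intr (quot k C m)).[b]) : (0 < k)%N ->
  q n = (C`_n)%:~R - b * (if (n < 2)%N then 0 else q (n - 2)%N)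
        - (if (n < k)%N then 0 else q (n - k)%N).
Proof.
move=> k0; rewrite /q quotE //; move: (quot k C (n - 2)) (quot k C (n - k)) => u v.
rewrite !rmorphB rmorphM /= map_polyX map_polyC /=.
rewrite !(hornerD, hornerN, hornerM, hornerX, hornerC).
by case: (n < 2)%N; case: (n < k)%N; rewrite ?rmorph0 ?horner0.
Qed.

Lemma quot_eval (L : fieldType) (k : nat) (C : {poly int}) (b : L) (q : nat -> L) :
  (0 < k)%N ->
  (forall n, (C`_n)%:~R = q n + b * (if (n < 2)%N then 0 else q (n - 2)%N)
                          + (if (n < k)%N then 0 else q (n - k)%N)) ->
  forall n, (map_poly intr (quot k C n)).[b] = q n.
Proof.
move=> k0 hq n; elim/ltn_ind: n => n IH; rewrite quot_evalE // hq.
have IH2 : (if (n < 2)%N then 0 else (map_poly intr (quot k C (n - 2))).[b])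
   = if (n < 2)%N then 0 else q (n - 2)%N by case: ltnP => // ?; rewrite IH //; lia.
have IHk : (if (n < k)%N then 0 else (map_poly intr (quot k C (n - k))).[b])
   = if (n < k)%N then 0 else q (n - k)%N by case: ltnP => // ?; rewrite IH //; lia.
by rewrite IH2 IHk; ring.
Qed.

(** Each step down by 2 contributes a factor [- y], while a step down by [k > 2]
    contributes none; so [y ^ j] appears only from index [2 j] on, and at
    [2 j] it comes from the single path of [j] steps by 2. *)
Lemma quot_coef k C n j : (2 < k)%N -> (n <= j.*2)%N ->
  (quot k C n)`_j = if n == j.*2 then (-1) ^+ j * C`_0 else 0.
Proof.
move=> k2; have k0 : (0 < k)%N by lia.
elim/ltn_ind: n j => n IH j nj.
rewrite quotE // !coefB coefC coefXM.
have -> : (if (n < k)%N then 0 else quot k C (n - k))`_j = 0.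
  case: ltnP => nk; first by rewrite coef0.
  by rewrite IH; [case: eqP => //; lia|lia|lia].
case: j nj => [|j] nj.
  have -> : n = 0%N by lia.
  by rewrite /= expr0 mul1r !subr0.
rewrite /= sub0r subr0; case: ltnP => n2.
  by rewrite coef0 oppr0; case: eqP => //; lia.
rewrite IH; [|lia|lia].
have -> : (n - 2 == j.*2)%N = (n == j.+1.*2) by apply/eqP/eqP; lia.
by case: eqP => // _; rewrite ?oppr0 // exprS mulN1r mulNr.
Qed.

(** Divisibility of [C] by [1 + y x ^ 2 + x ^ k] at a given [y] means that almost
    all [quot k C n] vanish at [y]. These are integer polynomials in [y], so
    what holds at [a] holds at its conjugates; those of even index have leading
    coefficient 1 or -1, which makes [a] an algebraic integer. *)
Lemma conjugate_divisor (K : numFieldType) (F : numClosedFieldType) (k : nat)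
    (a : K) (Q : {poly K}) (C : {poly int}) :
  (2 < k)%N -> a != 0 -> C`_0 = 1 ->
  (1 + a *: 'X^2 + 'X^k) * Q = map_poly intr C ->
  exists al : F, 1 <= `|al| /\
    forall z : F, 1 + al * z ^+ 2 + z ^+ k = 0 -> root (map_poly intr C) z.
Proof.
move=> k2 a0 C0 CE; have k0 : (0 < k)%N by lia.
have qa n : (map_poly intr (quot k C n)).[a] = Q`_n.
  move: n; apply: quot_eval => // n.
  by rewrite -coef_prod CE coef_map.
have [||al [al1 alP]] := @conjugate_norm_ge1 K F a (quot k C (size Q).*2) a0.
- by rewrite rootE qa nth_default // -addnn leq_addr.
- have top : (quot k C (size Q).*2)`_(size Q) = (-1) ^+ size Q.
    by rewrite quot_coef // eqxx C0 mulr1.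
  have -> : lead_coef (quot k C (size Q).*2) = (-1) ^+ size Q.
    rewrite -top lead_coefE; congr (_`_ _); suff -> : size (quot k C (size Q).*2) = (size Q).+1 by [].
    apply/eqP; rewrite eqn_leq; apply/andP; split.
      apply/leq_sizeP => j jQ; rewrite quot_coef //; last by lia.
      by case: eqP => //; lia.
    by rewrite ltnNge; apply/negP => /leq_sizeP/(_ _ (leqnn _))/eqP; rewrite top signr_eq0.
  by rewrite normrX normrN1 expr1n.
exists al; split=> // z hz.
pose Qal : {poly F} := \poly_(n < size Q) (map_poly intr (quot k C n)).[al].
have qal n : Qal`_n = (map_poly intr (quot k C n)).[al].
  rewrite coef_poly; case: ltnP => // nQ; apply/esym/eqP.
  by apply: alP; rewrite rootE qa nth_default.
have -> : map_poly intr C = (1 + al *: 'X^2 + 'X^k) * Qal.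
  apply/polyP => n; rewrite coef_prod coef_map /=.
  by rewrite !qal quot_evalE // [X in X + _]addrAC !subrK.
by rewrite rootE hornerM !hornerD hornerZ !hornerXn hornerC hz mul0r.
Qed.

(** * A trinomial root whose [k]-th power lies in a small disc *)

(** Vieta's formula for the sum of the inverses of the roots. *)
Lemma coef1_prod_XsubC (F : fieldType) (s : seq F) : all (predC1 0) s ->
  (\prod_(z <- s) ('X - z%:P))`_1
  = - (\prod_(z <- s) ('X - z%:P))`_0 * \sum_(z <- s) z^-1.
Proof.
elim: s => [|z s IH] /=; first by rewrite !big_nil mulr0 coef1.
move=> /andP[z0 s0]; rewrite !big_cons; set p := \prod_(_ <- _) _.
rewrite !mulrBl !coefB !coefXM !coefCM /= (IH s0) -/p.
by field.
Qed.

Lemma mem_le_mean (F : numDomainType) (s : seq F) (c : F) :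
  c \is Num.real -> all [in Num.real] s -> s != [::] ->
  \sum_(x <- s) x <= c *+ size s -> exists2 x, x \in s & x <= c.
Proof.
move=> cR sR s0 hs; apply/hasP; apply: contraLR hs => /hasPn hs.
have {}hs x : x \in s -> c < x.
  by move=> xs; rewrite real_ltNge ?hs // (allP sR).
rewrite real_leNgt ?negbK; last 2 first.
- by rewrite big_seq; apply: rpred_sum => x /(allP sR).
- exact: rpredMn.
have -> : c *+ size s = \sum_(x <- s) c by rewrite big_const_seq count_predT iter_addr_0.
case: s s0 hs {sR} => // x s _ hs; rewrite !big_cons.
apply: ltr_leD; first by apply: hs; rewrite mem_head.
rewrite [leLHS]big_seq [leRHS]big_seq; apply: ler_sum => y ys.
by apply/ltW/hs; rewrite inE ys orbT.
Qed.

(** With [u = z ^ 2] and [v = z ^ k], a root satisfies [al u = - (1 + v)] and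
    [u ^ k = v ^ 2], so [v] is a root of [V = (1 + v) ^ k + al ^ k v ^ 2].
    The two lowest coefficients of [V] are 1 and [k], hence the inverses of
    its [k] roots have mean [-1] and one of them has real part at most [-1].
    This says that [v] lies in the disc of diameter [-1, 0], which is the
    last conjunct. As [k] is odd, [z] is recovered as [v / u ^ (k %/ 2)]. *)
Lemma trinomial_root_disc (F : numClosedFieldType) (k : nat) (al : F) :
  odd k -> (2 < k)%N -> al != 0 ->
  exists z : F, [/\ 1 + al * z ^+ 2 + z ^+ k = 0, z != 0 &
    `|z ^+ k| ^+ 2 + `|1 + z ^+ k| ^+ 2 <= 1].
Proof.
move=> kodd k2 al0.
pose p : {poly F} := 'X - (-1)%:P.
pose V : {poly F} := p ^+ k + (al ^+ k) *: 'X^2.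
have szp : size (p ^+ k) = k.+1 by rewrite size_exp_XsubC.
have szlt : (size ((al ^+ k) *: 'X^2 : {poly F})%R < size (p ^+ k))%N.
  by rewrite szp (leq_ltn_trans (size_scale_leq _ _)) // size_polyXn.
have Vmonic : lead_coef V = 1.
  by rewrite lead_coefDl // (monicP _) // monic_exp ?monicXsubC.
have szV : size V = k.+1 by rewrite size_polyDl.
have V0 : V`_0 = 1.
  by rewrite coefD coefZ coefXn mulr0 addr0 -horner_coef0 horner_exp hornerXsubC sub0r opprK expr1n.
have V1 : V`_1 = k%:R.
  rewrite coefD coefZ coefXn mulr0 addr0 -[LHS]mulr1n -coef_deriv deriv_exp.
  rewrite derivXsubC mul1r coefMn -horner_coef0 horner_exp hornerXsubC sub0r.
  by rewrite opprK expr1n.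
have [s defV] := closed_field_poly_normal V.
rewrite Vmonic scale1r in defV.
have szs : size s = k by apply/eqP; rewrite -eqSS -szV defV size_prod_XsubC.
have rootE v : v \in s -> (1 + v) ^+ k + al ^+ k * v ^+ 2 = 0.
  rewrite -root_prod_XsubC -defV => /rootP.
  by rewrite /V /p !hornerE opprK [v + 1]addrC.
have s0 : all (predC1 0) s.
  apply/allP => v vs /=; apply/eqP => v0; have := rootE v vs.
  rewrite v0 addr0 expr1n expr0n mulr0 addr0; exact/eqP/oner_neq0.
have sumV : \sum_(v <- s) v^-1 = - k%:R.
  by have := coef1_prod_XsubC _ _ s0; rewrite -defV V0 V1 mulN1r => ->; rewrite opprK.
have [v vs] : exists2 v, v \in s & 'Re (v^-1) <= -1.
  have [||||t /mapP[v vs ->] ht] := @mem_le_mean F [seq 'Re (v^-1) | v <- s] (-1).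
  - by rewrite rpredN rpred1.
  - by apply/allP => _ /mapP[v _ ->]; exact: Creal_Re.
  - by rewrite -size_eq0 size_map szs; case: (k) k2.
  - by rewrite big_map -raddf_sum sumV size_map szs raddfN /= mulNrn (Creal_ReP _ _) ?rpred_nat.
  - by exists v.
move=> hv; have v0 : v != 0 by apply: (allP s0).
pose u := - (1 + v) / al.
have uk : u ^+ k = v ^+ 2.
  rewrite /u expr_div_n exprNn -signr_odd kodd expr1 mulN1r.
  have /eqP := rootE v vs; rewrite addr_eq0 => /eqP ->.
  by rewrite opprK mulrAC mulfV ?mul1r // expf_neq0.
have u0 : u != 0.
  apply/eqP => u0; move: uk; rewrite u0 expr0n; case: (k) k2 => //= ? _ /eqP.
  by rewrite eq_sym expf_eq0 (negPf v0).
have kE : k = (k./2.*2).+1 by rewrite -[LHS]odd_double_half kodd.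
set l := k./2 in kE.
have z2 : (v / u ^+ l) ^+ 2 = u.
  rewrite expr_div_n -uk {1}kE -exprM muln2 exprS mulfK //.
  exact: expf_neq0.
have zk : (v / u ^+ l) ^+ k = v.
  by rewrite {1}kE exprS -muln2 mulnC exprM z2 divfK // expf_neq0.
exists (v / u ^+ l); split; last 1 first.
- rewrite zk; have n0 : `|v| ^+ 2 != 0 by rewrite expf_neq0 // normr_eq0.
  have -> : 1 + v = v * (v^-1 + 1) by rewrite mulrDr mulfV // mulr1.
  have t2 : `|v^-1 + 1| ^+ 2 = `|v| ^- 2 + 2%:R * 'Re v^-1 + 1.
    rewrite -exprVn -normfV normC2_Re_Im [`|v^-1| ^+ 2]normC2_Re_Im !raddfD /=.
    rewrite (Creal_ReP 1 _) ?rpred1 // (Creal_ImP 1 _) ?rpred1 //; ring.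
  rewrite normrM exprMn t2 !mulrDr mulfV // mulr1 mulrA.
  have h : `|v| ^+ 2 * ('Re v^-1 + 1) <= 0.
    by rewrite mulr_ge0_le0 ?exprn_ge0 // -lerBrDr sub0r.
  rewrite -subr_le0; apply: le_trans (_ : 2%:R * (`|v| ^+ 2 * ('Re v^-1 + 1)) <= 0).
    by rewrite le_eqVlt; apply/orP; left; apply/eqP; ring.
  by rewrite mulr_ge0_le0.
- by rewrite zk z2 /u mulrC divfK // addrAC addrN.
- by rewrite mulf_neq0 // invr_neq0 // expf_neq0.
Qed.

(** * The product at a root inside the unit disc *)

Lemma tail_bound (F : numFieldType) (p : {poly F}) (M : nat) (z : F) :
  (forall n, (n < M)%N -> p`_n = 0) -> (forall n, `|p`_n| <= 1) -> `|z| <= 1 ->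
  `|p.[z]| * (1 - `|z|) <= `|z| ^+ M.
Proof.
move=> pM p1 z1; have z0 := normr_ge0 z.
have zc : 0 <= 1 - `|z| by rewrite subr_ge0.
have part N : (\sum_(i < N) `|p`_i| * `|z| ^+ i) * (1 - `|z|) <= `|z| ^+ M - `|z| ^+ maxn M N.
  elim: N => [|N IH]; first by rewrite big_ord0 mul0r maxn0 subrr.
  rewrite big_ord_recr /= mulrDl.
  have [NM|MN] := ltnP N M.
    by rewrite pM // normr0 !mul0r addr0; move: IH; rewrite !(maxn_idPl _) // ltnW.
  move: IH; rewrite (maxn_idPr MN) (maxn_idPr (leqW MN)) => IH.
  apply: le_trans (lerD IH (_ : _ <= `|z| ^+ N * (1 - `|z|))) _.
    by rewrite ler_wpM2r // ler_piMl // exprn_ge0.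
  by rewrite exprSr le_eqVlt; apply/orP; left; apply/eqP; ring.
rewrite horner_coef.
apply: le_trans (_ : (\sum_(i < size p) `|p`_i| * `|z| ^+ i) * (1 - `|z|) <= _).
  apply: ler_wpM2r => //; apply: le_trans (ler_norm_sum _ _ _) _.
  by apply: ler_sum => i _; rewrite normrM normrX.
by apply: le_trans (part _) _; rewrite lerBlDr lerDl exprn_ge0.
Qed.

(** Below [M] the polynomial [C] is the expansion of [(1 + x ^ k) / (1 - x ^ 2)],
    so [(1 - x ^ 2) C - (1 + x ^ k)] starts at [x ^ M]; its coefficients are
    differences of two values in [{0, 1}]. *)
Lemma prefix_root_bound (F : numFieldType) (C : {poly int}) (k M : nat) (z : F) :
  odd k -> (1 < k)%N -> (k < M)%N -> (forall n, C`_n = 0 \/ C`_n = 1) ->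
  (forall n, (n < M)%N -> C`_n = (~~ odd n || (k <= n)%N)%:R) ->
  root (map_poly intr C) z -> `|z| <= 1 ->
  `|1 + z ^+ k| * (1 - `|z|) <= `|z| ^+ M.
Proof.
move=> kodd k1 kM C01 Cpre /rootP Cz z1.
pose p : {poly int} := (1 - 'X^2) * C - (1 + 'X^k).
have coefp n : p`_n = C`_n - (if (n < 2)%N then 0 else C`_(n - 2)) - (n == 0%N)%:R - (n == k)%:R.
  by rewrite coefB mulrBl mul1r coefB coefXnM coefD coef1 coefXn opprD addrA.
have -> : 1 + z ^+ k = - (map_poly intr p : {poly F}).[z].
  rewrite rmorphB rmorphM /= !rmorphB !rmorphD !rmorph1 /= !map_polyXn.
  by rewrite !(hornerD, hornerN, hornerM, hornerXn, hornerC) Cz mulr0 sub0r opprK.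
have pM n : (n < M)%N -> p`_n = 0.
  move=> nM; rewrite coefp Cpre //; case: n nM => [|[|n]] nM /=.
  - by rewrite (ltn_eqF (ltnW k1)) !subr0 subrr.
  - by rewrite (ltn_eqF k1) leqNgt k1 !subr0.
  rewrite !subSS subn0 Cpre ?(ltn_trans _ nM) // negbK subr0.
  have [no|ne] /= := boolP (odd n); last first.
    have -> : (n.+2 == k) = false by apply/eqP => nk; move: kodd; rewrite -nk /= negbK (negPf ne).
    by [].
  have [nk|nk] := eqVneq n.+2 k; first by rewrite -nk leqnn leqNgt leqnSn.
  have -> : (k <= n)%N = (k <= n.+2)%N.
    rewrite [RHS]leq_eqVlt eq_sym (negPf nk) ltnS /= [RHS]leq_eqVlt ltnS.
    by case: eqVneq => // kn; move: kodd; rewrite kn /= no.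
  by rewrite subrr.
rewrite normrN; apply: tail_bound => // n; first by move=> nM; rewrite coef_map pM.
rewrite coef_map /= -intr_norm -[1]/(1%:~R) ler_int.
have [nM|Mn] := ltnP n M; first by rewrite pM // normr0.
have kn := leq_trans kM Mn.
rewrite coefp (gtn_eqF kn) (gtn_eqF (leq_ltn_trans (leq0n k) kn)) !subr0.
by case: ltnP => _; case: (C01 n) => ->; rewrite ?subr0 //; case: (C01 (n - 2)%N) => ->.
Qed.

(** If [x] is not close to 1, then [x ^ 30] is smaller than [1 - x]. If it is,
    the first inequality gives [x ^ (4 k) <= (1 - x ^ 4) ^ 2], which is
    quadratic in [1 - x] and so too small for the second one. *)
Lemma small_modulus_absurd (R : realFieldType) (x : R) (k : nat) :
  (7 <= k)%N -> 0 < x -> x ^+ k.*2 + x ^+ 4 <= 1 ->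
  x ^+ 2 * (1 - x) <= x ^+ (4 * k + 4) -> False.
Proof.
move=> hk x0 hsmall htail.
have x1 : x < 1.
  have := exprn_ge0 k.*2 (ltW x0) => h.
  have h4 : x ^+ 4 <= 1 by lra.
  have : x <= 1 by rewrite -(@expr_le1 _ 4%N) // ltW.
  rewrite le_eqVlt => /orP[/eqP xe|//].
  by move: hsmall; rewrite xe !expr1n; lra.
have tail30 : 1 - x <= x ^+ 30.
  have x2 : 0 < x ^+ 2 by exact: exprn_gt0.
  rewrite -(ler_pM2l x2) -exprD; apply: le_trans htail _.
  by apply: ler_wiXn2l; [exact: ltW|exact: ltW|lia].
have x91 : 91%:R / 100%:R < x.
  rewrite ltNge; apply/negP => xle.
  have p2 : x ^+ 2 <= 83%:R / 100%:R by nra.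
  have p4 : x ^+ 4 <= 69%:R / 100%:R.
    by rewrite (_ : x ^+ 4 = (x ^+ 2) ^+ 2) -?exprM //; have := exprn_ge0 2 (ltW x0); nra.
  have p6 : x ^+ 6 <= 58%:R / 100%:R.
    rewrite (_ : x ^+ 6 = x ^+ 2 * x ^+ 4) -?exprD //.
    by have := exprn_ge0 2 (ltW x0); have := exprn_ge0 4 (ltW x0); nra.
  have p12 : x ^+ 12 <= 34%:R / 100%:R.
    by rewrite (_ : x ^+ 12 = (x ^+ 6) ^+ 2) -?exprM //; have := exprn_ge0 6 (ltW x0); nra.
  have p24 : x ^+ 24 <= 12%:R / 100%:R.
    by rewrite (_ : x ^+ 24 = (x ^+ 12) ^+ 2) -?exprM //; have := exprn_ge0 12 (ltW x0); nra.
  have p30 : x ^+ 30 <= 7%:R / 100%:R.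
    rewrite (_ : x ^+ 30 = x ^+ 6 * x ^+ 24) -?exprD //.
    by have := exprn_ge0 6 (ltW x0); have := exprn_ge0 24 (ltW x0); nra.
  by lra.
have sq : x ^+ (4 * k) <= (1 - x ^+ 4) ^+ 2.
  rewrite (_ : (4 * k = k.*2 * 2)%N) ?exprM; last by lia.
  by rewrite lerXn2r ?nnegrE ?exprn_ge0 ?(ltW x0) //; have := exprn_ge0 k.*2 (ltW x0); lra.
have key : x ^+ 2 * (1 - x) <= x ^+ 4 * (1 - x ^+ 4) ^+ 2.
  apply: le_trans htail _; rewrite addnC exprD.
  by apply: ler_wpM2l => //; exact: exprn_ge0 (ltW x0).
have key2 : 1 <= x ^+ 2 * (1 - x) * (1 + x + x ^+ 2 + x ^+ 3) ^+ 2.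
  have h : 0 < x ^+ 2 * (1 - x) by apply: mulr_gt0; [exact: exprn_gt0|lra].
  rewrite -(ler_pM2l h) mulr1; apply: le_trans key _.
  by rewrite le_eqVlt; apply/orP; left; apply/eqP; ring.
(* On an interval inside [2 / 3 <= x] the factor [x ^ 2 (1 - x)] decreases and
   the other one increases, so each is bounded by its value at one endpoint.
   Three intervals are enough to keep the product of the two bounds below 1. *)
have bnd (c d : R) : 2%:R / 3%:R <= c -> c <= x -> x <= d ->
   x ^+ 2 * (1 - x) * (1 + x + x ^+ 2 + x ^+ 3) ^+ 2 <=
   c ^+ 2 * (1 - c) * (1 + d + d ^+ 2 + d ^+ 3) ^+ 2.
  move=> c23 cx xd.
  have d0 : 0 <= d by lra.
  have dx n : x ^+ n <= d ^+ n by rewrite lerXn2r ?nnegrE // ltW.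
  apply: ler_pM; rewrite ?sqr_ge0 //.
  - by apply: mulr_ge0; [exact: sqr_ge0|lra].
  - have : 0 <= (x - c) * (x ^+ 2 + x * c + c ^+ 2 - x - c).
      by apply: mulr_ge0; nra.
    by rewrite -subr_ge0 => h; apply: le_trans h _; rewrite le_eqVlt; apply/orP; left; apply/eqP; ring.
  - have e2 := dx 2%N; have e3 := dx 3%N.
    have f2 := exprn_ge0 2 (ltW x0); have f3 := exprn_ge0 3 (ltW x0).
    by rewrite lerXn2r ?nnegrE; lra.
have [h1|h1] := leP x (93%:R / 100%:R).
  by have := bnd (91%:R / 100%:R) (93%:R / 100%:R); move: key2; lra.
have [h2|h2] := leP x (95%:R / 100%:R).
  by have := bnd (93%:R / 100%:R) (95%:R / 100%:R); move: key2; lra.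
by have := bnd (95%:R / 100%:R) 1; move: key2; lra.
Qed.

(** * The theorem *)

(** The root found in [trinomial_root_disc] is a root of [C] for the large
    conjugate, and its modulus contradicts the bound coming from the prefix. *)
Lemma odd_exponent (R : realFieldType) (k : nat) (a : R) (Q : {poly R})
    (C : {poly int}) :
  (7 <= k)%N -> odd k -> 0 < a -> a < 1 -> (forall n, 0 <= Q`_n) ->
  (forall n, C`_n = 0 \/ C`_n = 1) ->
  (1 + a *: 'X^2 + 'X^k) * Q = map_poly intr C -> Q`_0 = 0.
Proof.
move=> k7 kodd a0 a1 Q0 C01 CE; apply/eqP; apply: contraT => Qn0.
have k2 : (2 < k)%N by lia.
have H : zero_one_product R k a (fun n => Q`_n) (fun n => (C`_n)%:~R).
  split=> // n; first by case: (C01 n) => ->; [left|right].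
  by rewrite -coef_prod CE coef_map.
have prefix n : (n < 4 * k + 4)%N -> C`_n = (~~ odd n || (k <= n)%N)%:R.
  have k4 : (4 < k)%N by lia.
  move=> nM; have := product_prefix R k a _ _ a0 a1 k4 kodd H Qn0 n nM.
  by case: (C01 n) => ->; case: (_ || _) => // /eqP; rewrite ?(eq_sym 0) oner_eq0.
have C0 : C`_0 = 1 by rewrite prefix //; lia.
have [al [al1 alC]] := conjugate_divisor R algC k a Q C k2 (lt0r_neq0 a0) C0 CE.
have al0 : al != 0 by rewrite -normr_gt0 (lt_le_trans ltr01).
have [z [Pz z0 small]] := trinomial_root_disc algC k al kodd k2 al0.
have Cz := alC z Pz.
have wE : `|1 + z ^+ k| = `|al| * `|z| ^+ 2.
  have -> : 1 + z ^+ k = - (al * z ^+ 2) by apply/eqP; rewrite -addr_eq0 -Pz; apply/eqP; ring.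
  by rewrite normrN normrM normrX.
have wge : `|z| ^+ 2 <= `|1 + z ^+ k| by rewrite wE ler_peMl // exprn_ge0.
have hsmall : `|z| ^+ k.*2 + `|z| ^+ 4 <= 1.
  apply: le_trans small; rewrite -normrX -muln2 normrX exprM -normrX lerD2l.
  by rewrite (_ : 4 = 2 * 2)%N // exprM lerXn2r ?nnegrE ?exprn_ge0.
have z1 : `|z| <= 1.
  rewrite -(@expr_le1 _ 4%N) //; apply: le_trans hsmall.
  by rewrite lerDr exprn_ge0.
have tail : `|z| ^+ 2 * (1 - `|z|) <= `|z| ^+ (4 * k + 4).
  apply: le_trans (_ : `|1 + z ^+ k| * (1 - `|z|) <= _).
    by rewrite ler_wpM2r // subr_ge0.
  have kM : (k < 4 * k + 4)%N by clear; lia.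
  exact: (prefix_root_bound algC C k _ z kodd (ltnW k2) kM C01 prefix Cz z1).
(* The modulus of [z] is moved to the ordered field of real algebraic numbers. *)
pose x := in_algR (normr_real z).
exfalso; apply: (small_modulus_absurd algR x k k7).
- by rewrite -[_ < _]/(algRval 0 < algRval x) rmorph0 normr_gt0.
- by rewrite -[_ <= _]/(algRval _ <= algRval _) rmorphD !rmorphXn rmorph1.
- by rewrite -[_ <= _]/(algRval _ <= algRval _) rmorphM rmorphB !rmorphXn rmorph1.
Qed.

Theorem theorem1p1 (R : realType) (k : nat) (a : R) (Q : {poly R})
    (hk : (7 <= k)%N) (ha0 : 0 < a) (ha1 : a < 1)
    (hQ : forall i : nat, 0 <= Q`_i)
    (hP : forall i : nat, ((1 + a *: 'X^2 + 'X^k) * Q)`_i = 0 \/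
                          ((1 + a *: 'X^2 + 'X^k) * Q)`_i = 1) :
  Q = 0.
Proof.
have [//|Qn0] := eqVneq Q 0; exfalso.
have exv : exists v, Q`_v != 0.
  by exists (size Q).-1; rewrite -lead_coefE lead_coef_eq0.
(* Removing the factor ['X^v] makes the constant coefficient nonzero. *)
case: (ex_minnP exv) => v Qv vmin.
have low i : (i < v)%N -> Q`_i = 0.
  by move=> iv; apply/eqP; apply: contraTT iv => /vmin; rewrite -leqNgt.
pose Q' := \poly_(i < size Q) Q`_(v + i).
have Q'E i : Q'`_i = Q`_(v + i).
  rewrite coef_poly; case: ltnP => // iQ.
  by rewrite nth_default // (leq_trans iQ) // leq_addl.
set P := 1 + a *: 'X^2 + 'X^k in hP.
have PE n : (P * Q')`_n = (P * Q)`_(v + n).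
  have sh d : (if (n < d)%N then 0 else Q'`_(n - d)) =
              (if (v + n < d)%N then 0 else Q`_(v + n - d)).
    have [nd|dn] := ltnP n d.
      by case: ltnP => // dvn; rewrite low //; lia.
    by rewrite ltnNge (leq_trans dn (leq_addl _ _)) /= Q'E addnBA.
  by rewrite !coef_prod !sh Q'E.
pose C : {poly int} := \poly_(n < size (P * Q')) ((P * Q')`_n == 1)%:R.
have CE : P * Q' = map_poly intr C.
  apply/polyP => n; rewrite coef_map coef_poly /=.
  case: ltnP => [_|nQ]; last by rewrite nth_default.
  by rewrite PE; case: (hP (v + n)%N) => ->; rewrite ?eqxx // eq_sym oner_eq0.
have C01 n : C`_n = 0 \/ C`_n = 1.
  by rewrite coef_poly; case: ifP => _; [case: eqP; [right|left]|left].
have Q'ge n : 0 <= Q'`_n by rewrite Q'E.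
suff : Q'`_0 = 0 by rewrite Q'E addn0 => /eqP; rewrite (negPf Qv).
have [kodd|kev] := boolP (odd k); first exact: (@odd_exponent R k a Q' C).
apply: (even_exponent R k a (fun n => Q'`_n) (fun n => (C`_n)%:~R)) => //; first by lia.
split=> // n; first by case: (C01 n) => ->; [left|right].
by rewrite -coef_prod -/P CE coef_map.
Qed.
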